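(* Let a price scenario $\omega\in\Omega$ and a PV generation budgeted uncertainty set $\mathcal U$ be given, and let $p^{\mathrm{DA}}\in\mathcal X$ be the fixed first-stage decision. Assume that day-ahead prices are positive and higher than the PV marginal cost, i.e. $\lambda^{\mathrm{DA}}_{t,\omega'}>c^{\mathrm{PV}}>0$ for all $t\in\mathcal T$ and all $\omega'\in\Omega$. As long as $$0<\kappa\le\min_{\omega'\in\Omega,\ t,t'\in\mathcal T,\ t\ne t'}\Bigl\{\tfrac12\bigl|\lambda^{\mathrm{DA}}_{t,\omega'}-\lambda^{\mathrm{DA}}_{t',\omega'}\bigr|,\ \lambda^{\mathrm{DA}}_{t,\omega'}-c^{\mathrm{PV}}\Bigr\},$$ the following hold for the second-stage problem $$V_\omega(p^{\mathrm{DA}})=\max_{\hat p^{\mathrm{PV}}\in\mathcal U}\ \min_{y\in\mathcal Y(p^{\mathrm{DA}},\hat p^{\mathrm{PV}})}\ \Phi^{\mathrm{RT}}(y;\omega).$$ (i) The optimal dispatch decision for PV generation in the second-stage problem satisfies $$p_t^{\mathrm{PV},*}(\omega)=\hat p_t^{\mathrm{PV},*}(\omega)\qquad\forall t\in\mathcal T,$$ where the worst-case PV availability $\hat p^{\mathrm{PV},*}(\omega)$ can be chosen as an optimal solution of $$\max_{\hat p^{\mathrm{PV}}\in\mathcal U}\ \sum_{t\in\mathcal T}-\lambda^{\mathrm{DA}}_{t,\omega}\,\hat p_t^{\mathrm{PV}}.$$ (ii) Given $p^{\mathrm{PV},*}(\omega)$, the second-stage problem $V_\omega(p^{\mathrm{DA}})$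 reduces to the deterministic problem $$\underline V_\omega(p^{\mathrm{DA}}):=\min_{\Delta e\in\mathcal Y_e}\ \sum_{t\in\mathcal T}f_{t,\omega}\bigl(\Delta e_t,\,p_t^{\mathrm{PV},*}(\omega),\,p_t^{\mathrm{DA}}\bigr),$$ that is, $V_\omega(p^{\mathrm{DA}})=\underline V_\omega(p^{\mathrm{DA}})$.
   Context: Let $\mathcal T=\{1,\dots,T\}$ be the set of hours, $\mathcal S=\{1,\dots,N\}$ a finite set of price states, and $\Omega$ a finite set of price scenarios. Each scenario $\omega$ carries a state sequence $(s_t(\omega))_{t\in\mathcal T}$ in $\mathcal S$ and a day-ahead price trajectory $\lambda^{\mathrm{DA}}_{t,\omega}=\pi_{t,s_t(\omega)}$, where $\pi_{t,s}$ is the representative price of state $s$ at hour $t$. The first-stage feasible set is $\mathcal X=\{(p^{\mathrm{DA}}_{t,s})_{t\in\mathcal T,s\in\mathcal S}:\ \underline p^{\mathrm{DA}}\le p^{\mathrm{DA}}_{t,s}\le\bar p^{\mathrm{DA}},\ p^{\mathrm{DA}}_{t,s}\le p^{\mathrm{DA}}_{t,s'}\text{ if }\pi_{t,s}\le\pi_{t,s'},\ \forall t\in\mathcal T,\ s,s'\in\mathcal S\}$ for given bounds $\underline p^{\mathrm{DA}},\bar p^{\mathrm{DA}}$. In scenario $\omega$ write $p_t^{\mathrm{DA}}:=p^{\mathrm{DA}}_{t,s_t(\omega)}$ for the committed net injection at hour $t$. Given constants: the load $p_t^\ell$, the PV marginal cost $c^{\mathrm{PV}}$, the battery degradation cost $c^{\mathrm{ES}}$,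 the charging and discharging efficiencies $\eta^{\mathrm{ch}},\eta^{\mathrm{dis}}\in(0,1]$, the storage power rating $\bar p^{\mathrm{ES}}$, the bounds $\underline e,\bar e$ on the state of charge, the initial state of charge $e_0$, and the imbalance parameter $\kappa>0$. PV uncertainty set: $\mathcal U=\{\hat p^{\mathrm{PV}}\in\mathbb R^{T}:\ \hat p_t^{\mathrm{PV}}=\tfrac{\bar p_t^{\mathrm{PV}}+\underline p_t^{\mathrm{PV}}}{2}+\tfrac{\bar p_t^{\mathrm{PV}}-\underline p_t^{\mathrm{PV}}}{2}\xi_t,\ |\xi_t|\le1\ \ \forall t\in\mathcal T,\ \ \sum_{t\in\mathcal T}|\xi_t|\le\Gamma\}$, where $\underline p_t^{\mathrm{PV}}$ and $\bar p_t^{\mathrm{PV}}$ are the lower and upper bounds of the PV availability forecast and $\Gamma\in[0,T]$. It is assumed that $\bar p_t^{\mathrm{PV}}-\underline p_t^{\mathrm{PV}}$ is the same constant for all $t\in\mathcal T$. Second-stage (real-time dispatch) feasible set: for $\hat p^{\mathrm{PV}}\in\mathcal U$, $\mathcal Y(p^{\mathrm{DA}},\hat p^{\mathrm{PV}})$ is the set of all $y=(p_t^{\mathrm{PV}},p_t^{\mathrm{ES,ch}},p_t^{\mathrm{ES,dis}},e_t,p_t^{\mathrm{mis}})_{t\in\mathcal T}$ satisfying, for all $t\in\mathcal T$: - PV: $0\le p_t^{\mathrm{PV}}\le\hat p_t^{\mathrm{PV}}$; - storage power: $0\le p_t^{\mathrm{ES,ch}}\le\bar p^{\mathrm{ES}}$,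 $0\le p_t^{\mathrm{ES,dis}}\le\bar p^{\mathrm{ES}}$, and no simultaneous charging and discharging, $p_t^{\mathrm{ES,ch}}\,p_t^{\mathrm{ES,dis}}=0$; the net storage output is $p_t^{\mathrm{ES}}=-p_t^{\mathrm{ES,ch}}+p_t^{\mathrm{ES,dis}}$; - state of charge: $e_t=e_{t-1}+\eta^{\mathrm{ch}}p_t^{\mathrm{ES,ch}}-p_t^{\mathrm{ES,dis}}/\eta^{\mathrm{dis}}$, $\underline e\le e_t\le\bar e$, and $e_T=e_0$; - imbalance: $p_t^{\mathrm{mis}}=p_t^{\mathrm{PV}}+p_t^{\mathrm{ES}}-p_t^\ell-p_t^{\mathrm{DA}}$. Real-time cost: with $[x]_+=\max\{x,0\}$, $$\Phi^{\mathrm{RT}}(y;\omega)=\sum_{t\in\mathcal T}\Bigl(c^{\mathrm{PV}}p_t^{\mathrm{PV}}+c^{\mathrm{ES}}p_t^{\mathrm{ES,dis}}+(\lambda^{\mathrm{DA}}_{t,\omega}+\kappa)[-p_t^{\mathrm{mis}}]_+-(\lambda^{\mathrm{DA}}_{t,\omega}-\kappa)[p_t^{\mathrm{mis}}]_+\Bigr).$$ Objects in the deterministic problem: the variable $\Delta e_t$ stands for $\eta^{\mathrm{ch}}p_t^{\mathrm{ES,ch}}-p_t^{\mathrm{ES,dis}}/\eta^{\mathrm{dis}}=e_t-e_{t-1}$, and $$\mathcal Y_e=\Bigl\{\Delta e\in\mathbb R^T:\ \underline e-e_0\le\sum_{\tau=1}^t\Delta e_\tau\le\bar e-e_0\ \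 \forall t\in\mathcal T\setminus\{T\},\ \ \sum_{\tau=1}^T\Delta e_\tau=0\Bigr\}.$$ With $\lambda^{+}_t=\lambda^{\mathrm{DA}}_{t,\omega}+\kappa$ and $\lambda^{-}_t=\lambda^{\mathrm{DA}}_{t,\omega}-\kappa$, $$\begin{aligned}f_{t,\omega}(\Delta e_t,p_t^{\mathrm{PV}},p_t^{\mathrm{DA}})=\max\bigl\{&\eta^{\mathrm{dis}}(\lambda^+_t-c^{\mathrm{ES}})\Delta e_t+(c^{\mathrm{PV}}-\lambda^+_t)p_t^{\mathrm{PV}}+\lambda^+_t(p_t^{\mathrm{DA}}+p_t^\ell),\\&(\lambda^+_t/\eta^{\mathrm{ch}})\Delta e_t+(c^{\mathrm{PV}}-\lambda^+_t)p_t^{\mathrm{PV}}+\lambda^+_t(p_t^{\mathrm{DA}}+p_t^\ell),\\&\eta^{\mathrm{dis}}(\lambda^-_t-c^{\mathrm{ES}})\Delta e_t+(c^{\mathrm{PV}}-\lambda^-_t)p_t^{\mathrm{PV}}+\lambda^-_t(p_t^{\mathrm{DA}}+p_t^\ell),\\&(\lambda^-_t/\eta^{\mathrm{ch}})\Delta e_t+(c^{\mathrm{PV}}-\lambda^-_t)p_t^{\mathrm{PV}}+\lambda^-_t(p_t^{\mathrm{DA}}+p_t^\ell)\bigr\}.\end{aligned}$$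
   Formalization: (ii) assumes that some minimizer of the deterministic problem respects the storage power rating; (i) gives an optimal dispatch with full PV, and full PV in every optimal one at hours with κ<λ−c^PV; c^ES≥0, rating≥0, 0≤PV lower≤upper bound and e_0 within bounds are assumed. *)

(* Defs.v *)
(* MathComp / MathComp-Analysis.  Hour t of {1,...,T} is the index t-1 : 'I_T;
   real T-vectors are row vectors, read as [x 0 t]. *)
From HB Require Import structures.
From mathcomp Require Import all_boot all_order all_algebra.
From mathcomp Require Import all_classical all_reals all_analysis.

Set Implicit Arguments.
Unset Strict Implicit.
Unset Printing Implicit Defensive.

Import Order.TTheory GRing.Theory Num.Theory.
Local Open Scope classical_set_scope.
Local Open Scope ring_scope.

Section Optimization.
Context {R : realType} {X : Type}.
Implicit Types (A : set X) (f : X -> \bar R).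

Definition argmax A f : set X :=
  [set x | A x /\ forall z, A z -> (f z <= f x)%E].
Definition argmin A f : set X :=
  [set x | A x /\ forall z, A z -> (f x <= f z)%E].

(* Extended-real optimal values (inf of the empty set is +oo); they are a
   genuine max / min exactly when argmax / argmin is nonempty. *)
Definition max_value A f : \bar R := ereal_sup (f @` A).
Definition min_value A f : \bar R := ereal_inf (f @` A).

End Optimization.

Definition pos_part {R : realType} (x : R) : R := Num.max x 0.

Record params (R : realType) (T N : nat) (Omega : finType) := Params {
  price : 'M[R]_(T, N);               (* pi_{t,s} *)
  state : Omega -> 'I_T -> 'I_N;      (* s_t(omega) *)
  pDA_lo : R;
  pDA_hi : R;
  load : 'rV[R]_T;                    (* p^l_t *)
  cPV : R;
  cES : R;
  eta_ch : R;
  eta_dis : R;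
  pES_max : R;
  soc_lo : R;
  soc_hi : R;
  soc_init : R;                       (* e_0 *)
  kappa : R;
  PV_lo : 'rV[R]_T;
  PV_hi : 'rV[R]_T;
  Gamma : R }.

Record dispatch (R : realType) (T : nat) := Dispatch {
  pPV : 'rV[R]_T;
  pch : 'rV[R]_T;
  pdis : 'rV[R]_T;
  soc : 'rV[R]_T;                     (* e_1, ..., e_T *)
  pmis : 'rV[R]_T }.

Section Model.
Context {R : realType} {T N : nat} {Omega : finType}.
Variable d : params R T N Omega.

Definition lambdaDA (w : Omega) (t : 'I_T) : R := price d t (state d w t).

Definition first_stage_set : set 'M[R]_(T, N) :=
  [set p | (forall t s, pDA_lo d <= p t s <= pDA_hi d) /\
           (forall t s s', price d t s <= price d t s' -> p t s <= p t s')].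

Definition committed (pDA : 'M[R]_(T, N)) (w : Omega) : 'rV[R]_T :=
  \row_t pDA t (state d w t).

Definition uncertainty_set : set 'rV[R]_T :=
  [set p | exists xi : 'rV[R]_T,
    [/\ forall t, p 0 t = (PV_hi d 0 t + PV_lo d 0 t) / 2
                          + (PV_hi d 0 t - PV_lo d 0 t) / 2 * xi 0 t,
        forall t, `|xi 0 t| <= 1
      & \sum_t `|xi 0 t| <= Gamma d]].

(* e_{t-1}, which is the given e_0 at the first hour *)
Definition soc_prev (y : dispatch R T) (t : 'I_T) : R :=
  if t == 0%N :> nat then soc_init d else soc y 0 (ord_pred t).

(* Y(p^DA, phat), with [pc] the committed net injection of the scenario *)
Definition dispatch_set (pc phat : 'rV[R]_T) : set (dispatch R T) :=
  [set y | forall t : 'I_T,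
    [/\ 0 <= pPV y 0 t <= phat 0 t,
        [/\ 0 <= pch y 0 t <= pES_max d,
            0 <= pdis y 0 t <= pES_max d
          & pch y 0 t * pdis y 0 t = 0],
        [/\ soc y 0 t = soc_prev y t + eta_ch d * pch y 0 t
                        - pdis y 0 t / eta_dis d,
            soc_lo d <= soc y 0 t <= soc_hi d
          & t.+1 = T -> soc y 0 t = soc_init d]
      & pmis y 0 t = pPV y 0 t + (- pch y 0 t + pdis y 0 t)
                     - load d 0 t - pc 0 t]].

Definition rt_cost (w : Omega) (y : dispatch R T) : R :=
  \sum_t (cPV d * pPV y 0 t + cES d * pdis y 0 t
          + (lambdaDA w t + kappa d) * pos_part (- pmis y 0 t)
          - (lambdaDA w t - kappa d) * pos_part (pmis y 0 t)).

Definition recourse_value (w : Omega) (pDA : 'M[R]_(T, N)) (phat : 'rV[R]_T)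
    : \bar R :=
  min_value (dispatch_set (committed pDA w) phat) (fun y => (rt_cost w y)%:E).

Definition second_stage_value (w : Omega) (pDA : 'M[R]_(T, N)) : \bar R :=
  max_value uncertainty_set (recourse_value w pDA).

Definition optimal_dispatch (w : Omega) (pDA : 'M[R]_(T, N))
    (phat : 'rV[R]_T) : set (dispatch R T) :=
  argmin (dispatch_set (committed pDA w) phat) (fun y => (rt_cost w y)%:E).

Definition worst_case (w : Omega) (pDA : 'M[R]_(T, N)) : set 'rV[R]_T :=
  argmax uncertainty_set (recourse_value w pDA).

Definition pv_lp_solution (w : Omega) : set 'rV[R]_T :=
  argmax uncertainty_set
    (fun phat => (\sum_t - lambdaDA w t * phat 0 t)%:E).

Definition Ye : set 'rV[R]_T :=
  [set De | (forall t : 'I_T, t.+1 != T ->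
               soc_lo d - soc_init d <= \sum_(tau < T | (tau <= t)%N) De 0 tau
                 <= soc_hi d - soc_init d) /\
            \sum_tau De 0 tau = 0].

Definition hour_cost (w : Omega) (t : 'I_T) (De p pc : R) : R :=
  let lp := lambdaDA w t + kappa d in
  let lm := lambdaDA w t - kappa d in
  let l := load d 0 t in
  Num.max
    (Num.max
       (eta_dis d * (lp - cES d) * De + (cPV d - lp) * p + lp * (pc + l))
       (lp / eta_ch d * De + (cPV d - lp) * p + lp * (pc + l)))
    (Num.max
       (eta_dis d * (lm - cES d) * De + (cPV d - lm) * p + lm * (pc + l))
       (lm / eta_ch d * De + (cPV d - lm) * p + lm * (pc + l))).

Definition deterministic_cost (w : Omega) (pDA : 'M[R]_(T, N))
    (pv De : 'rV[R]_T) : R :=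
  \sum_t hour_cost w t (De 0 t) (pv 0 t) (committed pDA w 0 t).

Definition deterministic_value (w : Omega) (pDA : 'M[R]_(T, N))
    (pv : 'rV[R]_T) : \bar R :=
  min_value Ye (fun De => (deterministic_cost w pDA pv De)%:E).

Definition deterministic_solution (w : Omega) (pDA : 'M[R]_(T, N))
    (pv : 'rV[R]_T) : set 'rV[R]_T :=
  argmin Ye (fun De => (deterministic_cost w pDA pv De)%:E).

(* De_t = eta_ch * pch_t - pdis_t / eta_dis for some charging and discharging
   powers allowed by the rating.  Ye itself does not mention the rating. *)
Definition respects_rating (De : 'rV[R]_T) : Prop :=
  forall t : 'I_T, exists c g : R,
    [/\ 0 <= c <= pES_max d, 0 <= g <= pES_max d, c * g = 0
      & De 0 t = eta_ch d * c - g / eta_dis d].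

End Model.

(* Main.v *)
Require Import Defs.
From HB Require Import structures.
From mathcomp Require Import all_boot all_order all_algebra.
From mathcomp Require Import all_classical all_reals all_analysis.
From mathcomp Require Import lra ring.

Import Order.TTheory GRing.Theory Num.Theory.
Import numFieldNormedType.Exports.
Local Open Scope classical_set_scope.
Local Open Scope ring_scope.

(** The imbalance cost of an hour with imbalance [x] is [kappa * |x| - lambda * x]
    ([imbalance_costE]).  So if the storage schedule is held fixed and only the
    PV output changes, the cost saved per extra unit of PV in hour [t] is a
    number [m t], minus a secant slope of the cost, that lies between
    [lambda t - cPV - kappa] and [lambda t - cPV + kappa] ([set_pv_cost]).  The
    two bounds on [kappa] say that these savings are nonnegative and, the
    intervals of distinct hours having disjoint interiors, that they are ordered
    like the prices.

    Nonnegative savings make it optimal to use all the available PV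
    ([full_pv_cost]).  For the worst case, a solution of the linear program with
    weights [lambda] spends the uncertainty budget greedily on the most
    expensive hours; since the widths of the forecast intervals agree, only the
    order of the weights matters, and the same point is optimal for the weights
    [m] ([budgeted_max_reweight], [pv_lp_reweight]).  Hence any dispatch that is
    feasible under the linear-program solution can be turned, by moving only its
    PV output, into one that is feasible under a given other availability and is
    not more expensive ([pv_lp_worst]).

    For the reduction, absence of simultaneous charging and discharging makes
    the charging and discharging powers functions of the change [De] of the
    state of charge.  Efficiencies at most 1 and a nonnegative degradation cost
    make the applicable one of the charging and discharging branches the larger
    one, and the cost of an hour becomes the maximum of four affine functions
    ([hour_costE], [rt_cost_schedule]).  With all the PV used, the recourse
    problem is thus the deterministic problem restricted to the schedules that
    the power rating allows, and both have the same value as soon as one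
    deterministic solution respects the rating ([second_stage_deterministic]).

    All the minima and maxima exist by compactness ([argmin_box_nonempty]). *)

(** * Linear programs over a budgeted box *)

Lemma sum_update (V : zmodType) (X : Type) n (F : 'I_n -> X -> V)
    (x : 'I_n -> X) (t : 'I_n) (a : X) :
  \sum_i F i (if i == t then a else x i)
  = \sum_i F i (x i) + (F t a - F t (x t)).
Proof.
rewrite (bigD1 t)//= [in RHS](bigD1 t)//= eqxx.
under eq_bigr => i /negPf -> do [].
by rewrite addrC [F t (x t) + _]addrC -addrA addrC subrKC addrC.
Qed.

Definition budgeted {R : realFieldType} {n : nat} (G : R) (z : 'I_n -> R) :=
  (forall i, `|z i| <= 1) /\ \sum_i `|z i| <= G.

(** For positive weights [l], a maximizer [x] is a greedy one: it spends the
    whole budget and saturates the heavier entries first. *)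
Section BudgetedLP.
Context {R : realFieldType} {n : nat} {G : R} {l x : 'I_n -> R}.
Hypothesis l_gt0 : forall i, 0 < l i.
Hypothesis x_in : budgeted G x.
Hypothesis x_max :
  forall z, budgeted G z -> \sum_i l i * z i <= \sum_i l i * x i.

(** Changing one entry within the budget cannot improve a maximizer, and as the
    weight of that entry is positive, the entry cannot have increased. *)
Lemma budgeted_max_local (t : 'I_n) (a : R) :
  `|a| <= 1 -> \sum_i `|x i| + (`|a| - `|x t|) <= G -> a <= x t.
Proof.
move=> a1 aG; have [x1 _] := x_in.
pose z i := if i == t then a else x i.
have z_in : budgeted G z.
  split=> [i|]; first by rewrite /z; case: eqP.
  by rewrite (sum_update _ _ _ (fun=> Num.norm)).
have := x_max _ z_in; rewrite (sum_update _ _ _ (fun i => *%R (l i))).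
by rewrite -lerBrDl subrr subr_le0 ler_pM2l.
Qed.

(** Flipping the sign of an entry costs no budget. *)
Lemma budgeted_max_ge0 (t : 'I_n) : 0 <= x t.
Proof.
have [x1 xG] := x_in.
have := @budgeted_max_local t (- x t); rewrite normrN subrr addr0.
move=> /(_ (x1 t) xG); lra.
Qed.

(** Otherwise some entry is below 1, for all entries equal to 1 would sum to
    [n >= G], and the rest of the budget can raise it. *)
Lemma budgeted_max_sum : G <= n%:R -> \sum_i x i = G.
Proof.
move=> Gn; have [x1 xG] := x_in.
have xE i : `|x i| = x i by rewrite ger0_norm// budgeted_max_ge0.
rewrite (eq_bigr _ (fun i _ => xE i)) in xG.
apply/eqP; rewrite eq_le xG leNgt; apply/negP => ltG.
have sat t : x t = 1.
  apply/eqP; rewrite eq_le; apply/andP; split.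
    by rewrite -xE.
  rewrite leNgt; apply/negP => lt1.
  pose a := Num.min 1 (x t + (G - \sum_i x i)).
  have xt := budgeted_max_ge0 t.
  have at_ : x t < a by rewrite lt_min lt1/= ltrDl subr_gt0.
  have a1 : a <= 1 by rewrite ge_min lexx.
  have aS : a <= x t + (G - \sum_i x i) by rewrite ge_min lexx orbT.
  have aE : `|a| = a by rewrite ger0_norm//; lra.
  have := @budgeted_max_local t a; rewrite aE xE (eq_bigr _ (fun i _ => xE i)).
  move=> /(_ a1) le_a; have : a <= x t by apply: le_a; lra.
  by rewrite leNgt at_.
move: ltG; rewrite (eq_bigr _ (fun i _ => sat i)) sumr_const card_ord.
by rewrite ltNge Gn.
Qed.

(** Moving a little budget from [s] to the heavier [t] would improve [x]. *)
Lemma budgeted_max_exchange (s t : 'I_n) : l s < l t -> x t = 1 \/ x s = 0.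
Proof.
move=> lst; have [x1 xG] := x_in.
have st : s != t by apply: contraTneq lst => ->; rewrite ltxx.
have xE i : `|x i| = x i by rewrite ger0_norm// budgeted_max_ge0.
have xs := budgeted_max_ge0 s; have xt := budgeted_max_ge0 t.
have := x1 s; have := x1 t; rewrite !xE => xt1 xs1.
have [|xtn1] := eqVneq (x t) 1; first by left.
have [|xsn0] := eqVneq (x s) 0; first by right.
exfalso.
pose e := Num.min (1 - x t) (x s).
have e0 : 0 < e by rewrite lt_min; apply/andP; split;
  [rewrite subr_gt0 lt_neqAle xtn1|rewrite lt_neqAle eq_sym xsn0].
have et : e <= 1 - x t by rewrite ge_min lexx.
have es : e <= x s by rewrite ge_min lexx orbT.
pose y i := if i == s then x s - e else x i.
pose z i := if i == t then x t + e else y i.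
have yt : y t = x t by rewrite /y eq_sym (negPf st).
have z_in : budgeted G z.
  split=> [i|].
    rewrite /z /y; case: eqP => _; [|case: eqP => _//];
      by rewrite ger0_norm; lra.
  rewrite (sum_update _ _ _ (fun=> Num.norm)) (sum_update _ _ _ (fun=> Num.norm)).
  rewrite yt !xE (ger0_norm (_ : 0 <= x t + e)) ?(ger0_norm (_ : 0 <= x s - e)); lra.
have := x_max _ z_in; rewrite !(sum_update _ _ _ (fun i => *%R (l i))) yt.
rewrite leNgt => /negP; apply.
have : 0 < (l t - l s) * e by rewrite mulr_gt0// subr_gt0.
lra.
Qed.

(** A greedy point stays optimal for weights in the same order.  The proof
    exhibits the Lagrange multiplier [th] of the budget constraint for the
    weights [m]: the largest weight of an unsaturated entry.  By the exchange
    property it is at most every weight that receives budget, so that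
    [(m i - th) * (x i - |z i|)] is nonnegative for each [i]. *)
Lemma budgeted_max_reweight (m : 'I_n -> R) : G <= n%:R ->
    (forall s t, s != t -> l s != l t) ->
    (forall t, 0 <= m t) ->
    (forall s t, l s < l t -> m s <= m t) ->
  forall z, budgeted G z -> \sum_i m i * z i <= \sum_i m i * x i.
Proof.
move=> Gn l_inj m_ge0 m_mono z [z1 zG].
have x_ge0 := budgeted_max_ge0; have [x1 _] := x_in.
have xE i : `|x i| = x i by rewrite ger0_norm.
pose th := \big[Num.max/0]_(i | x i != 1) m i.
have th_ge0 : 0 <= th by exact: bigmax_ge_id.
have th_ub i : x i != 1 -> m i <= th by move=> xi; exact: le_bigmax_cond.
have th_lb i : x i != 0 -> th <= m i.
  move=> xi; apply/bigmax_leP; split=> // s xs.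
  have [->//|si] := eqVneq s i.
  have [|lsi] := ltP (l s) (l i); first exact: m_mono.
  have : l i < l s by rewrite lt_neqAle lsi andbT l_inj// eq_sym.
  by move=> /budgeted_max_exchange[/eqP|/eqP]; rewrite ?(negPf xs) ?(negPf xi).
apply: (@le_trans _ _ (\sum_i m i * `|z i|)).
  by apply: ler_sum => i _; rewrite ler_wpM2l// ler_norm.
rewrite -subr_ge0 -sumrB.
(* replace m by m - th, which is exact on x since x exhausts the budget *)
have xzG : 0 <= th * (\sum_i x i - \sum_i `|z i|).
  by rewrite mulr_ge0// subr_ge0 budgeted_max_sum.
apply: (le_trans xzG); rewrite -sumrB mulr_sumr; apply: ler_sum => i _.
rewrite -mulrBr -subr_ge0 -mulrBl.
have [xi1|xi1] := eqVneq (x i) 1.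
  by rewrite mulr_ge0// subr_ge0 ?th_lb ?xi1 ?oner_neq0.
have [xi0|xi0] := eqVneq (x i) 0; last first.
  suff -> : m i = th by rewrite subrr mul0r.
  by apply/eqP; rewrite eq_le th_ub ?th_lb.
by rewrite xi0 sub0r mulrN oppr_ge0 mulr_le0_ge0// subr_le0 th_ub.
Qed.

End BudgetedLP.

(** * Attained optimal values *)

Lemma argmin_value (R : realType) (X : Type) (A : set X) (f : X -> \bar R) x :
  argmin A f x -> min_value A f = f x.
Proof.
move=> [Ax xmin]; apply/eqP; rewrite eq_le; apply/andP; split.
  by apply: ereal_inf_lbound; exists x.
by apply: le_ereal_inf_tmp => _ [z Az <-]; exact: xmin.
Qed.

Lemma argmax_value (R : realType) (X : Type) (A : set X) (f : X -> \bar R) x :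
  argmax A f x -> max_value A f = f x.
Proof.
move=> [Ax xmax]; apply/eqP; rewrite eq_le; apply/andP; split.
  by apply: ge_ereal_sup => _ [z Az <-]; exact: xmax.
by apply: ereal_sup_ubound; exists x.
Qed.

(** * PV availabilities *)

Section Model.
Context {R : realType} {T N : nat} {Omega : finType}.
Variable d : params R T N Omega.

(** The availability with budget variables [xi = - z]; the sign turns lowering
    the availability into maximizing over budgeted [z]. *)
Definition pv_of_shortfall (z : 'I_T -> R) : 'rV[R]_T :=
  \row_t ((PV_hi d 0 t + PV_lo d 0 t) / 2
          - (PV_hi d 0 t - PV_lo d 0 t) / 2 * z t).

Lemma uncertainty_setP (p : 'rV[R]_T) : uncertainty_set d p <->
  exists2 z, budgeted (Gamma d) z & p = pv_of_shortfall z.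
Proof.
split=> [[xi [pE xi1 xiG]]|[z [z1 zG] ->]].
  exists (fun t => - xi 0 t).
    by split=> [t|]; [rewrite normrN|under eq_bigr do rewrite normrN].
  by apply/rowP => t; rewrite mxE pE mulrN opprK.
exists (\row_t - z t); split=> [t|t|]; rewrite ?mxE ?normrN ?mulrN//.
by under eq_bigr do rewrite mxE normrN.
Qed.

Lemma uncertainty_ge0 (p : 'rV[R]_T) :
  (forall t, 0 <= PV_lo d 0 t <= PV_hi d 0 t) ->
  uncertainty_set d p -> forall t, 0 <= p 0 t.
Proof.
move=> lohi [xi [pE xi1 _]] t; rewrite pE.
have /andP[lo0 lo_hi] := lohi t; have := xi1 t; rewrite ler_norml => /andP[xi_ge _].
have : 0 <= (PV_hi d 0 t - PV_lo d 0 t) * (1 + xi 0 t) by rewrite mulr_ge0; lra.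
lra.
Qed.

(** With a common half-width [D], the objective with weights [m] is a constant
    minus [D] times the objective of the budgeted program in the shortfall. *)
Lemma pv_lp_reweight (w : Omega) (phat q : 'rV[R]_T) (m : 'I_T -> R) :
    Gamma d <= T%:R ->
    (forall t t', PV_hi d 0 t - PV_lo d 0 t = PV_hi d 0 t' - PV_lo d 0 t') ->
    (forall t, PV_lo d 0 t <= PV_hi d 0 t) ->
    (forall t, 0 < lambdaDA d w t) ->
    (forall s t, s != t -> lambdaDA d w s != lambdaDA d w t) ->
    (forall t, 0 <= m t) ->
    (forall s t, lambdaDA d w s < lambdaDA d w t -> m s <= m t) ->
    pv_lp_solution d w phat -> uncertainty_set d q ->
  \sum_t m t * phat 0 t <= \sum_t m t * q 0 t.
Proof.
move=> GT width lohi l_gt0 l_inj m_ge0 m_mono [/uncertainty_setP[x x_in ->] lp].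
move=> /uncertainty_setP[z z_in ->].
case: (pickP (@predT 'I_T)) => [t0 _|T0]; last first.
  by rewrite !big1// => t; have := T0 t.
pose D := (PV_hi d 0 t0 - PV_lo d 0 t0) / 2.
have D_ge0 : 0 <= D by rewrite divr_ge0// subr_ge0.
pose c (k : 'I_T -> R) := \sum_t k t * ((PV_hi d 0 t + PV_lo d 0 t) / 2).
have pvE k y : \sum_t k t * pv_of_shortfall y 0 t
    = c k - D * \sum_t k t * y t.
  rewrite /c mulr_sumr -sumrB; apply: eq_bigr => t _.
  by rewrite mxE (width t t0) mulrBr -/D [in X in _ - X]mulrCA.
rewrite !pvE lerD2l lerN2; have [D0|D0] := eqVneq D 0.
  by rewrite D0 !mul0r.
have D_gt0 : 0 < D by rewrite lt_neqAle eq_sym D0.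
rewrite ler_pM2l//; apply: (budgeted_max_reweight l_gt0 x_in _ m GT) => //.
move=> y y_in; rewrite -(ler_pM2l D_gt0).
have /lp : uncertainty_set d (pv_of_shortfall y).
  by apply/uncertainty_setP; exists y.
have lE v : \sum_t - lambdaDA d w t * pv_of_shortfall v 0 t
    = D * (\sum_t lambdaDA d w t * v t) - c (lambdaDA d w).
  rewrite -opprB -pvE -sumrN; apply: eq_bigr => t _.
  by rewrite mulNr.
by rewrite lee_fin !lE lerD2r.
Qed.

End Model.

(** * Moving the PV output of a dispatch *)

Lemma imbalance_costE (R : realType) (l k x : R) :
  (l + k) * pos_part (- x) - (l - k) * pos_part x = k * `|x| - l * x.
Proof.
rewrite /pos_part; have [x0|x0] := lerP 0 x.
  by rewrite [Num.max (- x) 0]max_r ?oppr_le0// ger0_norm//; lra.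
by rewrite [Num.max (- x) 0]max_l ?oppr_ge0 1?ltW// ltr0_norm//; lra.
Qed.

Section Model.
Context {R : realType} {T N : nat} {Omega : finType}.
Variable d : params R T N Omega.

Definition set_pv (y : dispatch R T) (p : 'rV[R]_T) : dispatch R T :=
  Dispatch p (pch y) (pdis y) (soc y) (pmis y + (p - pPV y)).

Lemma set_pv_feasible (pc phat phat' p : 'rV[R]_T) y : dispatch_set d pc phat y ->
  (forall t, 0 <= p 0 t <= phat' 0 t) -> dispatch_set d pc phat' (set_pv y p).
Proof.
move=> yY p_in t; have [_ ES SOC mis] := yY t; split=> //=.
by rewrite !mxE mis; lra.
Qed.

(** Here [m t] is minus the secant slope of the cost of hour [t]; the ratio [r t] of
    the increments of [|x|] and [x], for [x] the imbalance, is at most 1 in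
    absolute value. *)
Lemma set_pv_cost w y (p : 'rV[R]_T) : 0 <= kappa d -> exists m : 'I_T -> R,
  (forall t, lambdaDA d w t - cPV d - kappa d <= m t
             <= lambdaDA d w t - cPV d + kappa d) /\
  rt_cost d w (set_pv y p)
    = rt_cost d w y + \sum_t m t * (pPV y 0 t - p 0 t).
Proof.
move=> k_ge0.
pose r t := (`|pmis y 0 t + (p 0 t - pPV y 0 t)| - `|pmis y 0 t|)
            / (p 0 t - pPV y 0 t).
have r1 t : `|r t| <= 1.
  rewrite /r; have [->|ne] := eqVneq (p 0 t - pPV y 0 t) 0.
    by rewrite invr0 mulr0 normr0 ler01.
  rewrite normrM normfV ler_pdivrMr ?normr_gt0// mul1r.
  by apply: le_trans (ler_dist_dist _ _) _; rewrite addrC addKr.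
exists (fun t => lambdaDA d w t - cPV d - kappa d * r t); split=> [t|].
  have : `|kappa d * r t| <= kappa d by rewrite normrM ger0_norm// ler_piMr.
  by rewrite ler_norml; lra.
rewrite /rt_cost -big_split; apply: eq_bigr => t _ /=; rewrite !mxE.
have split4 (a b c e : R) : a + b + c - e = a + b + (c - e) by lra.
rewrite !split4 !imbalance_costE.
have rE : r t * (p 0 t - pPV y 0 t)
    = `|pmis y 0 t + (p 0 t - pPV y 0 t)| - `|pmis y 0 t|.
  rewrite /r; have [->|ne] := eqVneq (p 0 t - pPV y 0 t) 0.
    by rewrite mulr0 addr0 subrr.
  by rewrite divfK.
have : kappa d * (r t * (p 0 t - pPV y 0 t))
    = kappa d * (`|pmis y 0 t + (p 0 t - pPV y 0 t)| - `|pmis y 0 t|).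
  by rewrite rE.
lra.
Qed.

End Model.

(** * Dispatches and storage schedules *)

(** The left branch is the cost rate of discharging and the right one that of
    charging.  While charging, the left branch is too small by the factor
    [ed * ec <= 1] and by [ce >= 0]; while discharging, the right branch is too
    negative by the factor [(ec * ed)^-1 >= 1] and by [ce]. *)
Lemma max_storage_branches (R : realFieldType) (ec ed l ce c g a b : R) :
    0 < ec <= 1 -> 0 < ed <= 1 -> 0 <= l -> 0 <= ce ->
    0 <= c -> 0 <= g -> c * g = 0 ->
  Num.max (ed * (l - ce) * (ec * c - g / ed) + a + b)
          (l / ec * (ec * c - g / ed) + a + b)
  = ce * g + l * (c - g) + a + b.
Proof.
move=> /andP[ec0 ec1] /andP[ed0 ed1] l0 ce0 c0 g0 /eqP.
have ecn : ec != 0 by rewrite gt_eqF.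
have edn : ed != 0 by rewrite gt_eqF.
rewrite mulf_eq0 => /orP[] /eqP ->.
  rewrite !(mulr0, sub0r) max_l ?lerD2r.
    by congr (_ + _ + _); field.
  have -> : l / ec * - (g / ed) = - ((l * g) * (ec * ed)^-1).
    by field; rewrite ecn edn.
  have -> : ed * (l - ce) * - (g / ed) = - ((l - ce) * g) by field.
  rewrite lerN2; apply: (@le_trans _ _ (l * g)).
    by rewrite ler_wpM2r// gerBl.
  rewrite ler_peMr ?mulr_ge0// invf_ge1 ?mulr_gt0//.
  by rewrite mulr_ile1// ltW.
rewrite !(mul0r, mulr0, subr0, add0r) max_r ?lerD2r.
  by congr (_ + _ + _); field.
have -> : l / ec * (ec * c) = l * c by field.
have -> : ed * (l - ce) * (ec * c) = (ed * ec) * ((l - ce) * c) by ring.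
apply: (@le_trans _ _ ((ed * ec) * (l * c))).
  have eced : 0 <= ed * ec by rewrite mulr_ge0// ltW.
  by rewrite ler_wpM2l// ler_wpM2r// gerBl.
by rewrite ler_piMl ?mulr_ge0// mulr_ile1// ltW.
Qed.

Lemma pos_part_cases (R : realType) (x : R) :
  (pos_part x = x /\ pos_part (- x) = 0 /\ 0 <= x) \/
  (pos_part x = 0 /\ pos_part (- x) = - x /\ x < 0).
Proof.
rewrite /pos_part; have [x0|x0] := leP 0 x; [left|right]; do 2?split=> //.
  by rewrite max_r// oppr_le0.
by rewrite max_l// oppr_ge0 ltW.
Qed.

Section Model.
Context {R : realType} {T N : nat} {Omega : finType}.
Variable d : params R T N Omega.

(** The inner maxima resolve the storage, and the outer one is
    [kappa * |x| - lambda * x = max (- (lambda + kappa) * x)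
    (- (lambda - kappa) * x)]. *)
Lemma hour_costE w t (c g p pc : R) :
    0 < eta_ch d <= 1 -> 0 < eta_dis d <= 1 -> 0 <= cES d -> 0 <= kappa d ->
    kappa d <= lambdaDA d w t ->
    0 <= c -> 0 <= g -> c * g = 0 ->
  let x := p + (- c + g) - load d 0 t - pc in
  hour_cost d w t (eta_ch d * c - g / eta_dis d) p pc
  = cPV d * p + cES d * g
    + (lambdaDA d w t + kappa d) * pos_part (- x)
    - (lambdaDA d w t - kappa d) * pos_part x.
Proof.
move=> ec ed ce k0 kl c0 g0 cg x.
rewrite -addrA imbalance_costE /hour_cost !max_storage_branches//; last 2 first.
- by rewrite subr_ge0.
- by rewrite addr_ge0// (le_trans k0).
have [x0|x0] := lerP 0 x.
  have kx : 0 <= kappa d * x by rewrite mulr_ge0.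
  by rewrite ger0_norm// max_r; rewrite /x in kx *; lra.
have kx : kappa d * x <= 0 by rewrite mulr_ge0_le0// ltW.
by rewrite ltr0_norm// max_l; rewrite /x in kx *; lra.
Qed.

Definition schedule (y : dispatch R T) : 'rV[R]_T :=
  \row_t (eta_ch d * pch y 0 t - pdis y 0 t / eta_dis d).

Lemma rt_cost_schedule w pDA phat y :
    0 < eta_ch d <= 1 -> 0 < eta_dis d <= 1 -> 0 <= cES d -> 0 <= kappa d ->
    (forall t, kappa d <= lambdaDA d w t) ->
    dispatch_set d (committed d pDA w) phat y ->
  rt_cost d w y = deterministic_cost d w pDA (pPV y) (schedule y).
Proof.
move=> ec ed ce k0 kl yY; apply: eq_bigr => t _.
have [_ [/andP[c0 _] /andP[g0 _] cg] _ ->] := yY t.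
by rewrite [schedule y 0 t]mxE hour_costE.
Qed.

Definition cumul (De : 'rV[R]_T) (t : 'I_T) : R :=
  \sum_(tau < T | (tau <= t)%N) De 0 tau.

Lemma cumul_first (De : 'rV[R]_T) (t : 'I_T) :
  t = 0%N :> nat -> cumul De t = De 0 t.
Proof.
move=> t0; rewrite /cumul (big_pred1 t)// => s /=.
by rewrite t0 leqn0 -(inj_eq val_inj)/= t0.
Qed.

Lemma ord_predE (t : 'I_T) : (0 < t)%N -> ord_pred t = t.-1 :> nat.
Proof.
case: t => -[//|t] tT _ /=.
by rewrite modnDr modn_small// ltnW.
Qed.

Lemma cumul_next (De : 'rV[R]_T) (t : 'I_T) :
  (0 < t)%N -> cumul De t = cumul De (ord_pred t) + De 0 t.
Proof.
move=> t0; rewrite /cumul (bigD1 t)// [LHS]addrC; congr (_ + _).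
apply: eq_bigl => s; rewrite ord_predE// -[RHS]ltnS prednK// ltn_neqAle andbC.
by rewrite -(inj_eq val_inj).
Qed.

Lemma cumul_last (De : 'rV[R]_T) (t : 'I_T) :
  t.+1 = T -> cumul De t = \sum_tau De 0 tau.
Proof.
by move=> tT; apply: eq_bigl => s; rewrite -ltnS tT ltn_ord.
Qed.

Lemma soc_schedule pc phat y : dispatch_set d pc phat y ->
  forall t, soc y 0 t = soc_init d + cumul (schedule y) t.
Proof.
move=> yY [n nT]; elim: n nT => [|n IH] nT; set t := Ordinal nT;
  have [_ _ [-> _ _] _] := yY t; rewrite /soc_prev.
  by rewrite cumul_first// mxE addrA.
rewrite cumul_next// [schedule y 0 t]mxE /=.
have -> : ord_pred t = Ordinal (ltnW nT).
  by apply: val_inj; exact: ord_predE.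
by rewrite IH; lra.
Qed.

Lemma schedule_Ye pc phat y : (0 < T)%N -> dispatch_set d pc phat y ->
  Ye d (schedule y).
Proof.
move=> T0 yY; have socE := soc_schedule _ _ _ yY; split=> [t _|].
  have [_ _ [_ + _] _] := yY t; rewrite socE -/(cumul _ _); lra.
have lt : (T.-1 < T)%N by rewrite prednK.
have lastT : (Ordinal lt).+1 = T by rewrite /= prednK.
have [_ _ [_ _ +] _] := yY (Ordinal lt); move=> /(_ lastT).
by rewrite socE cumul_last//; lra.
Qed.

(** The schedules allowed by the power rating, written as a product of intervals,
    which makes the set visibly closed. *)
Definition rating_box : set 'rV[R]_T :=
  [set De | forall t, - (pES_max d / eta_dis d) <= De 0 t
                      <= eta_ch d * pES_max d].

Lemma respects_rating_box De : 0 < eta_ch d -> 0 < eta_dis d ->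
  respects_rating d De -> rating_box De.
Proof.
move=> ec ed De_ok t; have [c [g [/andP[c0 c1] /andP[g0 g1] _ ->]]] := De_ok t.
have : 0 <= eta_ch d * c by rewrite mulr_ge0// ltW.
have : 0 <= g / eta_dis d by rewrite divr_ge0// ltW.
have : eta_ch d * c <= eta_ch d * pES_max d by rewrite ler_pM2l.
have : g / eta_dis d <= pES_max d / eta_dis d by rewrite ler_pM2r ?invr_gt0.
lra.
Qed.

Lemma schedule_respects_rating pc phat y : dispatch_set d pc phat y ->
  respects_rating d (schedule y).
Proof.
move=> yY t; have [_ [c g cg] _ _] := yY t.
by exists (pch y 0 t), (pdis y 0 t); rewrite mxE.
Qed.

(** Increases of the state of charge are charged and decreases discharged, so one
    of the two powers is zero in each hour. *)
Definition dispatch_of (pc phat De : 'rV[R]_T) : dispatch R T :=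
  let c := \row_t (pos_part (De 0 t) / eta_ch d) in
  let g := \row_t (eta_dis d * pos_part (- De 0 t)) in
  Dispatch phat c g (\row_t (soc_init d + cumul De t))
    (phat + (- c + g) - load d - pc).

Lemma schedule_dispatch_of pc phat De : 0 < eta_ch d -> 0 < eta_dis d ->
  schedule (dispatch_of pc phat De) = De.
Proof.
move=> ec ed; apply/rowP => t; rewrite !mxE.
rewrite mulrCA divff ?gt_eqF// mulr1 mulrAC divff ?gt_eqF// mul1r.
by have [[-> [-> _]]|[-> [-> _]]] := pos_part_cases _ (De 0 t); lra.
Qed.

(** [Ye] leaves out the last hour of the state-of-charge bounds; there the state
    of charge returns to its initial value, which is within the bounds. *)
Lemma dispatch_of_feasible (pc phat De : 'rV[R]_T) : 0 < eta_ch d -> 0 < eta_dis d ->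
    soc_lo d <= soc_init d <= soc_hi d -> 0 <= pES_max d ->
    (forall t, 0 <= phat 0 t) -> Ye d De -> rating_box De ->
  dispatch_set d pc phat (dispatch_of pc phat De).
Proof.
move=> ec ed e0 P0 ph0 [De_soc De_sum] De_box t.
have ec0 := ltW ec; have ed0 := ltW ed.
have /rowP/(_ t) := schedule_dispatch_of pc phat De ec ed; rewrite mxE => DeE.
split; first by rewrite /= ph0 lexx.
- have := De_box t; rewrite !mxE.
  have [[-> [-> x0]]|[-> [-> x0]]] := pos_part_cases _ (De 0 t);
    rewrite !(mul0r, mulr0) lexx P0; split=> //.
    by rewrite divr_ge0// ler_pdivrMr// mulrC; lra.
  by rewrite mulr_ge0 ?oppr_ge0 ?(ltW x0)// mulrC -ler_pdivlMr//; lra.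
- have cumT : t.+1 = T -> cumul De t = 0 by move=> tT; rewrite cumul_last.
  split.
  + rewrite -addrA DeE /soc_prev !mxE.
    have [t0|t0] := posnP t; first by rewrite cumul_first.
    by rewrite cumul_next// addrA.
  + rewrite mxE; have [/cumT ->|tT] := eqVneq t.+1 T; first by rewrite addr0.
    by have := De_soc t tT; rewrite -/(cumul _ _); lra.
  + by move=> /cumT; rewrite mxE => ->; rewrite addr0.
- by rewrite !mxE.
Qed.

End Model.

(** * Existence of optimal solutions *)

Lemma sum_coord_continuous (R : realType) n (P : pred 'I_n)
    (F : 'I_n -> R -> R) : (forall t, continuous (F t)) ->
  continuous (fun v : 'rV[R]_n => \sum_(t | P t) F t (v 0 t)).
Proof.
move=> Fc; apply: continuous_big => [|t _ v]; first exact: add_continuous.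
by apply: continuous_comp; [exact: coord_continuous|exact: Fc].
Qed.

Lemma closed_sublevel (R : realType) (X : topologicalType) (f : X -> R) c :
  continuous f -> closed [set x | f x <= c].
Proof. by move=> /continuous_closedP/(_ _ (@closed_le _ c)). Qed.

Lemma closed_superlevel (R : realType) (X : topologicalType) (f : X -> R) c :
  continuous f -> closed [set x | c <= f x].
Proof. by move=> /continuous_closedP/(_ _ (@closed_ge _ c)). Qed.

Lemma closed_forall (X : topologicalType) (I : Type) (A : I -> set X) :
  (forall i, closed (A i)) -> closed [set x | forall i, A i x].
Proof.
move=> Ac; rewrite (_ : mkset _ = \bigcap_(i in setT) A i).
  by apply: closed_bigI => i _.
by apply/seteqP; split=> x /= xA; [move=> i _|move=> i; apply: xA].
Qed.

Lemma argmin_box_nonempty (R : realType) n (A : set 'rV[R]_n) (M : R)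
    (f : 'rV[R]_n -> R) :
    A !=set0 -> closed A -> (forall v, A v -> forall t, `|v 0 t| <= M) ->
    continuous f ->
  argmin A (fun v => (f v)%:E) !=set0.
Proof.
move=> A0 Acl AM fc.
have Ac : compact A.
  apply: (subclosed_compact Acl
    (@rV_compact R n (fun=> `[- M, M]%classic) _)).
    by move=> _; exact: segment_compact.
  by move=> v /AM vM t /=; rewrite in_itv/= -ler_norml.
have [v vA vmin] := EVT_min_rV A0 Ac (continuous_subspaceT fc).
exists v; split=> [|z Az]; first exact: set_mem.
by rewrite lee_fin vmin// mem_set.
Qed.

Section Model.
Context {R : realType} {T N : nat} {Omega : finType}.
Variable d : params R T N Omega.

Lemma pv_lp_nonempty w : 0 <= Gamma d -> pv_lp_solution d w !=set0.
Proof.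
move=> G0; pose B := [set v : 'rV[R]_T | budgeted (Gamma d) (v 0)].
have Bcl : closed B.
  apply: closedI.
    apply: (@closed_forall _ _ (fun t => [set v : 'rV[R]_T | `|v 0 t| <= 1])).
    move=> t; apply: closed_sublevel => v.
    by apply: continuous_comp; [exact: coord_continuous|exact: norm_continuous].
  apply: closed_sublevel; apply: (@sum_coord_continuous _ _ _ (fun=> Num.norm)).
  by move=> t; exact: norm_continuous.
have B0 : B !=set0.
  exists 0; split=> [t|]; first by rewrite mxE normr0.
  by rewrite big1// => t _; rewrite mxE normr0.
pose F t (z : R) := lambdaDA d w t * ((PV_hi d 0 t + PV_lo d 0 t) / 2
          - (PV_hi d 0 t - PV_lo d 0 t) / 2 * z).
have Fc t : continuous (F t).
  move=> z; apply: cvgM; first exact: cvg_cst.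
  apply: cvgB; first exact: cvg_cst.
  by apply: cvgM; [exact: cvg_cst|exact: cvg_id].
have [v [vB vmin]] := argmin_box_nonempty _ _ _ 1 _ B0 Bcl
  (fun v vB t => vB.1 t) (sum_coord_continuous _ _ predT F Fc).
have FE z : \sum_t - lambdaDA d w t * pv_of_shortfall d z 0 t
    = - \sum_t F t (z t).
  by rewrite -sumrN; apply: eq_bigr => t _; rewrite mxE mulNr.
exists (pv_of_shortfall d (v 0)); split.
  by apply/uncertainty_setP; exists (v 0).
move=> _ /uncertainty_setP[z z_in ->]; rewrite lee_fin !FE lerN2.
have zE : (\row_t z t) 0 =1 z by move=> t; rewrite mxE.
have := vmin (\row_t z t); rewrite lee_fin.
under [X in _ <= X]eq_bigr do rewrite zE.
apply; case: z_in => z1 zG; split=> [t|]; first by rewrite zE.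
by under eq_bigr do rewrite zE.
Qed.

Lemma closed_Ye : closed (Ye d).
Proof.
have cc t : continuous (fun v : 'rV[R]_T => cumul v t).
  by apply: (@sum_coord_continuous _ _ _ (fun=> id)) => _ z; exact: cvg_id.
have cs : continuous (fun v : 'rV[R]_T => \sum_tau v 0 tau).
  by apply: (@sum_coord_continuous _ _ _ (fun=> id)) => _ z; exact: cvg_id.
pose A (t : 'I_T) := [set v : 'rV[R]_T | t.+1 != T ->
  soc_lo d - soc_init d <= cumul v t <= soc_hi d - soc_init d].
rewrite (_ : Ye d = [set v | forall t, A t v] `&`
                    [set v | \sum_tau v 0 tau = 0])//.
apply: closedI; last by have /continuous_closedP/(_ _ (@closed_eq _ 0)) := cs.
apply: closed_forall => t; rewrite /A.
have [tT|tT] := boolP (t.+1 != T).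
  rewrite (_ : mkset _ =
    [set v : 'rV[R]_T | soc_lo d - soc_init d <= cumul v t] `&`
    [set v : 'rV[R]_T | cumul v t <= soc_hi d - soc_init d]).
    by apply: closedI; [exact: closed_superlevel|exact: closed_sublevel].
  apply/seteqP; split=> v /=; first by move=> /(_ isT)/andP.
  by move=> [-> ->].
rewrite (_ : mkset _ = setT); first exact: closedT.
by apply/seteqP.
Qed.

Lemma closed_rating_box : closed (rating_box d).
Proof.
apply: (@closed_forall _ _ (fun t => [set v : 'rV[R]_T |
  - (pES_max d / eta_dis d) <= v 0 t <= eta_ch d * pES_max d])) => t.
rewrite (_ : mkset _ =
  [set v : 'rV[R]_T | - (pES_max d / eta_dis d) <= v 0 t] `&`
  [set v : 'rV[R]_T | v 0 t <= eta_ch d * pES_max d]).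
  by apply: closedI; [apply: closed_superlevel|apply: closed_sublevel];
    exact: coord_continuous.
by apply/seteqP; split=> v /=; [move=> /andP|move=> [-> ->]].
Qed.

(** Each change is the difference of two states of charge. *)
Lemma Ye_bounded De : soc_lo d <= soc_init d <= soc_hi d -> Ye d De ->
  forall t, `|De 0 t| <= soc_hi d - soc_lo d.
Proof.
move=> e0 [De_soc De_sum] t.
have soc_in s : soc_lo d - soc_init d <= cumul De s <= soc_hi d - soc_init d.
  have [sT|] := eqVneq s.+1 T; last exact: De_soc.
  by rewrite cumul_last// De_sum; lra.
have := soc_in t; have [t0|t0] := posnP t.
  by rewrite cumul_first// ler_norml; lra.
by have := soc_in (ord_pred t); rewrite (cumul_next _ _ t0) ler_norml; lra.
Qed.

Lemma deterministic_cost_continuous w pDA pv :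
  continuous (deterministic_cost d w pDA pv).
Proof.
pose F t De := hour_cost d w t De (pv 0 t) (committed d pDA w 0 t).
apply: (sum_coord_continuous _ _ predT F) => t.
have aff (a b c : R) : continuous (fun x : R => a * x + b + c).
  move=> x; apply: cvgD; last exact: cvg_cst.
  apply: cvgD; last exact: cvg_cst.
  by apply: cvgM; [exact: cvg_cst|exact: cvg_id].
have cmax (f g : R -> R) : continuous f -> continuous g ->
    continuous (fun x => Num.max (f x) (g x)).
  by move=> fc gc x; apply: (@continuous_max R R); [exact: fc|exact: gc].
by rewrite /F /hour_cost; apply: (cmax); apply: (cmax); exact: aff.
Qed.

Lemma Ye0 : soc_lo d <= soc_init d <= soc_hi d -> Ye d 0.
Proof.
by move=> e0; split=> [t _|]; rewrite big1 ?subr_le0 ?subr_ge0// => t' _;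
  rewrite mxE.
Qed.

Lemma deterministic_solution_nonempty w pDA pv :
    soc_lo d <= soc_init d <= soc_hi d ->
  deterministic_solution d w pDA pv !=set0.
Proof.
move=> e0; apply: argmin_box_nonempty (deterministic_cost_continuous _ _ _).
- by exists 0; exact: Ye0.
- exact: closed_Ye.
- by move=> De; exact: Ye_bounded.
Qed.

Lemma rated_solution_nonempty w pDA pv :
    0 <= eta_ch d -> 0 <= eta_dis d -> 0 <= pES_max d ->
    soc_lo d <= soc_init d <= soc_hi d ->
  argmin (Ye d `&` rating_box d)
    (fun De => (deterministic_cost d w pDA pv De)%:E) !=set0.
Proof.
move=> ec ed P0 e0.
apply: argmin_box_nonempty (deterministic_cost_continuous _ _ _).
- exists 0; split; first exact: Ye0.
  by move=> t; rewrite mxE oppr_le0 divr_ge0// mulr_ge0.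
- by apply: closedI; [exact: closed_Ye|exact: closed_rating_box].
- by move=> De [DeY _]; exact: Ye_bounded.
Qed.

End Model.

(** * The second-stage problem *)

Section SecondStage.
Context {R : realType} {T N : nat} {Omega : finType}.
Variables (d : params R T N Omega) (w : Omega) (pDA : 'M[R]_(T, N)).
Hypothesis T_gt0 : (0 < T)%N.
Hypothesis eta_ch01 : 0 < eta_ch d <= 1.
Hypothesis eta_dis01 : 0 < eta_dis d <= 1.
Hypothesis Gamma_le : Gamma d <= T%:R.
Hypothesis width_const : forall t t' : 'I_T,
  PV_hi d 0 t - PV_lo d 0 t = PV_hi d 0 t' - PV_lo d 0 t'.
Hypothesis PV_bounds : forall t : 'I_T, 0 <= PV_lo d 0 t <= PV_hi d 0 t.
Hypothesis soc_init_in : soc_lo d <= soc_init d <= soc_hi d.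
Hypothesis pES_max_ge0 : 0 <= pES_max d.
Hypothesis cES_ge0 : 0 <= cES d.
Hypothesis cPV_gt0 : 0 < cPV d.
Hypothesis kappa_gt0 : 0 < kappa d.
Hypothesis kappa_le_gap : forall t t' : 'I_T, t != t' ->
  kappa d <= 2^-1 * `|lambdaDA d w t - lambdaDA d w t'|.
Hypothesis kappa_le_margin : forall t : 'I_T,
  kappa d <= lambdaDA d w t - cPV d.

Notation pc := (committed d pDA w).

Let kappa_ge0 : 0 <= kappa d := ltW kappa_gt0.

Let kappa_le_price t : kappa d <= lambdaDA d w t.
Proof. by have := kappa_le_margin t; have := cPV_gt0; lra. Qed.

(** Using curtailed PV does not raise the cost of any hour; the term kept on the
    left for a single hour [t] makes the saving strict when the margin of that
    hour is. *)
Lemma full_pv_cost phat y t : dispatch_set d pc phat y ->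
  rt_cost d w (set_pv y phat)
    + (lambdaDA d w t - cPV d - kappa d) * (phat 0 t - pPV y 0 t)
  <= rt_cost d w y.
Proof.
move=> yY; have [m [m_in ->]] := set_pv_cost d w y phat kappa_ge0.
have slack s : 0 <= phat 0 s - pPV y 0 s.
  by have [/andP[_ ?] _ _ _] := yY s; rewrite subr_ge0.
rewrite -addrA gerDl (bigD1 t)//= addrAC -subr_ge0 sub0r opprD addr_ge0//.
  have /andP[mt _] := m_in t.
  have : 0 <= (m t - (lambdaDA d w t - cPV d - kappa d))
              * (phat 0 t - pPV y 0 t) by rewrite mulr_ge0// subr_ge0.
  lra.
rewrite oppr_ge0 sumr_le0// => s _; rewrite mulr_ge0_le0//.
  by have := m_in s; have := kappa_le_margin s; lra.
by have := slack s; lra.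
Qed.

Lemma full_pv_feasible phat y : uncertainty_set d phat ->
  dispatch_set d pc phat y -> dispatch_set d pc phat (set_pv y phat).
Proof.
move=> /(uncertainty_ge0 _ _ PV_bounds) p0 /set_pv_feasible; apply.
by move=> t; rewrite p0 lexx.
Qed.

Lemma full_pv_le phat y : dispatch_set d pc phat y ->
  rt_cost d w (set_pv y phat) <= rt_cost d w y.
Proof.
move=> yY; apply: le_trans (full_pv_cost phat y (Ordinal T_gt0) yY).
rewrite lerDl mulr_ge0 ?subr_ge0//.
by have [/andP[]] := yY (Ordinal T_gt0).
Qed.

(** After raising the PV output to [phat], moving it to [q] changes the cost by
    [\sum_t m t * (phat t - q t)], and [phat] minimizes the objective with
    weights [m]. *)
Lemma pv_lp_worst phat q y : pv_lp_solution d w phat ->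
    uncertainty_set d q -> dispatch_set d pc phat y ->
  exists2 y', dispatch_set d pc q y' & rt_cost d w y' <= rt_cost d w y.
Proof.
move=> lp qU yY; have q0 := uncertainty_ge0 d q PV_bounds qU.
exists (set_pv (set_pv y phat) q).
  apply: (set_pv_feasible d _ phat) => [|t]; last by rewrite q0 lexx.
  by apply: full_pv_feasible => //; case: lp.
apply: le_trans (full_pv_le phat y yY).
have [m [m_in ->]] := set_pv_cost d w (set_pv y phat) q kappa_ge0.
rewrite gerDl /=; under eq_bigr do rewrite mulrBr.
rewrite sumrB subr_le0; apply: (pv_lp_reweight d w) => // [t|t|s t st|t|s t st].
- by have /andP[] := PV_bounds t.
- exact: lt_le_trans (kappa_le_price t).
- apply: contraTneq kappa_gt0 => lst.
  by have := kappa_le_gap _ _ st; rewrite lst subrr normr0 mulr0 leNgt.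
- by have := m_in t; have := kappa_le_margin t; lra.
have s_t : s != t by apply: contraTneq st => ->; rewrite ltxx.
have := kappa_le_gap _ _ s_t; rewrite ltr0_norm ?subr_lt0// => gap.
by have := m_in s; have := m_in t; lra.
Qed.

(** Replacing the PV output of a dispatch by [phat] does not raise its cost, which
    then depends on the storage schedule alone; so a minimizer over the compact
    set of rated schedules gives an optimal dispatch. *)
Lemma optimal_dispatch_exists phat : uncertainty_set d phat ->
  exists De, [/\ Ye d De,
    optimal_dispatch d w pDA phat (dispatch_of d pc phat De)
  & rt_cost d w (dispatch_of d pc phat De)
      = deterministic_cost d w pDA phat De].
Proof.
move=> pU; have /andP[ec _] := eta_ch01; have /andP[ed _] := eta_dis01.
have p0 := uncertainty_ge0 d phat PV_bounds pU.
have [De [[DeY DeB] DeMin]] := rated_solution_nonempty d w pDA phat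
  (ltW ec) (ltW ed) pES_max_ge0 soc_init_in.
have DeF := dispatch_of_feasible d pc phat De ec ed soc_init_in pES_max_ge0
  p0 DeY DeB.
have DeC : rt_cost d w (dispatch_of d pc phat De)
    = deterministic_cost d w pDA phat De.
  by rewrite (rt_cost_schedule d w pDA phat)// schedule_dispatch_of.
exists De; split=> //; split=> // y yY; rewrite lee_fin DeC.
apply: le_trans (full_pv_le phat y yY).
have yF := full_pv_feasible phat y pU yY.
rewrite (rt_cost_schedule d w pDA phat)// -lee_fin; apply: DeMin; split.
  exact: schedule_Ye yF.
exact: respects_rating_box (schedule_respects_rating _ _ _ _ yF).
Qed.

Lemma optimal_full_pv_exists phat : uncertainty_set d phat ->
  exists2 y, optimal_dispatch d w pDA phat y &
    forall t, pPV y 0 t = phat 0 t.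
Proof.
move=> /optimal_dispatch_exists[De [_ DeO _]].
by exists (dispatch_of d pc phat De).
Qed.

Lemma pv_lp_worst_case phat : pv_lp_solution d w phat ->
  worst_case d w pDA phat.
Proof.
move=> lp; split=> [|q qU]; first by case: lp.
apply: le_ereal_inf_tmp => _ [y yY <-].
have [y' y'Y le_y] := pv_lp_worst phat q y lp qU yY.
by apply: ge_ereal_inf; exists (rt_cost d w y')%:E; [exists y'|rewrite lee_fin].
Qed.

Lemma optimal_pv_full phat y t : uncertainty_set d phat ->
    optimal_dispatch d w pDA phat y -> kappa d < lambdaDA d w t - cPV d ->
  pPV y 0 t = phat 0 t.
Proof.
move=> pU [yY ymin] kt; have := full_pv_cost phat y t yY.
have := ymin _ (full_pv_feasible phat y pU yY); rewrite lee_fin => le1 le2.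
have [/andP[_ ple] _ _ _] := yY t.
apply/eqP; rewrite eq_le ple leNgt -subr_gt0; apply/negP => slack.
have : 0 < (lambdaDA d w t - cPV d - kappa d) * (phat 0 t - pPV y 0 t).
  by rewrite mulr_gt0// subr_gt0.
lra.
Qed.

(** The recourse value is the minimum of the deterministic cost over the rated
    schedules, so it is at least the minimum over all of [Ye]; a rated minimizer
    over [Ye] gives a feasible dispatch of the same cost. *)
Lemma second_stage_deterministic phat : pv_lp_solution d w phat ->
    (exists2 De, deterministic_solution d w pDA phat De
               & respects_rating d De) ->
  second_stage_value d w pDA = deterministic_value d w pDA phat.
Proof.
move=> lp [De DeS DeR].
have /andP[ec _] := eta_ch01; have /andP[ed _] := eta_dis01.
have pU : uncertainty_set d phat by case: lp.
rewrite [LHS](argmax_value _ _ _ _ _ (pv_lp_worst_case phat lp)).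
rewrite [RHS](argmin_value _ _ _ _ _ DeS); have [DeY DeMin] := DeS.
have [Dr [DrY DrO DrC]] := optimal_dispatch_exists phat pU.
rewrite [LHS](argmin_value _ _ _ _ _ DrO).
apply/eqP; rewrite eq_le [X in _ && X]lee_fin DrC -lee_fin DeMin// andbT.
have p0 := uncertainty_ge0 d phat PV_bounds pU.
have DeF := dispatch_of_feasible d pc phat De ec ed soc_init_in pES_max_ge0
  p0 DeY (respects_rating_box d De ec ed DeR).
rewrite -DrC; apply: (le_trans (DrO.2 _ DeF)).
by rewrite lee_fin (rt_cost_schedule d w pDA phat)// schedule_dispatch_of.
Qed.

End SecondStage.

Theorem proposition2 (R : realType) (T N : nat) (Omega : finType)
    (d : params R T N Omega) (w : Omega) (pDA : 'M[R]_(T, N))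
    (T_gt0 : (0 < T)%N)
    (eta_ch01 : 0 < eta_ch d <= 1)
    (eta_dis01 : 0 < eta_dis d <= 1)
    (Gamma_0T : 0 <= Gamma d <= T%:R)
    (width_const : forall t t' : 'I_T,
       PV_hi d 0 t - PV_lo d 0 t = PV_hi d 0 t' - PV_lo d 0 t')
    (PV_bounds : forall t : 'I_T, 0 <= PV_lo d 0 t <= PV_hi d 0 t)
    (soc_init_in : soc_lo d <= soc_init d <= soc_hi d)
    (pES_max_ge0 : 0 <= pES_max d)
    (cES_ge0 : 0 <= cES d)
    (pDA_in : first_stage_set d pDA)
    (price_gt : forall (w' : Omega) (t : 'I_T), lambdaDA d w' t > cPV d)
    (cPV_gt0 : 0 < cPV d)
    (kappa_gt0 : 0 < kappa d)
    (kappa_le_gap : forall (w' : Omega) (t t' : 'I_T), t != t' ->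
       kappa d <= 2^-1 * `|lambdaDA d w' t - lambdaDA d w' t'|)
    (kappa_le_margin : forall (w' : Omega) (t : 'I_T),
       kappa d <= lambdaDA d w' t - cPV d) :
  pv_lp_solution d w !=set0 /\
  forall phat : 'rV[R]_T, pv_lp_solution d w phat ->
    (* (i) *)
    [/\ worst_case d w pDA phat,
        (exists2 y, optimal_dispatch d w pDA phat y &
           forall t : 'I_T, pPV y 0 t = phat 0 t)
      & (forall y, optimal_dispatch d w pDA phat y ->
           forall t : 'I_T, kappa d < lambdaDA d w t - cPV d ->
             pPV y 0 t = phat 0 t)] /\
    (* (ii) *)
    (deterministic_solution d w pDA phat !=set0 /\
     ((exists2 De, deterministic_solution d w pDA phat De &
         respects_rating d De) ->
      second_stage_value d w pDA = deterministic_value d w pDA phat)).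
Proof.
have /andP[Gamma_ge0 Gamma_le] := Gamma_0T.
have gap := kappa_le_gap w; have margin := kappa_le_margin w.
split=> [|phat lp]; first exact: pv_lp_nonempty.
have pU : uncertainty_set d phat by case: lp.
split; first split.
- exact: pv_lp_worst_case lp.
- exact: optimal_full_pv_exists.
- by move=> y yO t; apply: optimal_pv_full yO.
split; first exact: deterministic_solution_nonempty.
exact: second_stage_deterministic lp.
Qed.
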